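(* Up to isomorphism, \[ \mathcal H_8=\mathcal F_7,\qquad \mathcal H_9=\mathcal F_8\cup\{K_{5,5},\,K_{5,5}-e\}. \] In particular, $|\mathcal H_8|=24$ and $|\mathcal H_9|=26$.
   Context: All graphs are finite and simple; containment of subgraphs is not necessarily induced. $\overline H$ is the complement of $H$. Edges of $H$ are called red and edges of $\overline H$ blue. $K_{5,5}-e$ is $K_{5,5}$ with one edge removed. For $n\in\{8,9\}$, $\mathcal H_n$ is the set of isomorphism classes of graphs $H$ of order $n+1$ such that $H$ contains no $C_n$ and $\overline H$ contains no $C_6$. For $r\in\{7,8\}$, $\mathcal F_r$ is the set of isomorphism classes of graphs $H$ constructed as follows. The vertex set is $X\cup\{y,z\}$, where $|X|=r$ and $y,z$ are two additional vertices. The induced graph is $H[X]=K_r-F$, where $F$ is the graph of blue edges on $X$. Each of $y,z$ has at most one red neighbor in $X$. The attachment of $y$ (respectively $z$) is its unique red neighbor in $X$ if it has one, and is $\bot$ if it has no red neighbor in $X$. Put $\varepsilon=1$ if $yz$ is red (an edge of $H$) and $\varepsilon=0$ if $yz$ is blue. The permitted choices, up to isomorphism, of $F$, of the pair of attachments of $(y,z)$, and of $\varepsilon$ are the following (vertices of $X$ not mentioned in $F$ are isolated in $F$): (1) $F$ has no edges; attachments $(\bot,\bot)$, $(a,\bot)$, or $(a,a)$ with $a\in X$; $\varepsilon\in\{0,1\}$. (2) $F$ has no edges; attachments $(a,b)$ with $a\ne b$ in $X$; $\varepsilon=0$. (3) $F$ is a single edge $ab$; attachments $(\bot,\bot)$;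 $\varepsilon\in\{0,1\}$. (4) $F$ is a single edge $ab$; attachments $(a',\bot)$, with either $a'\in\{a,b\}$ or $a'\in X\setminus\{a,b\}$; $\varepsilon\in\{0,1\}$. (5) $F$ is a single edge $ab$; attachments $(a',a')$, with either $a'\in\{a,b\}$ or $a'\in X\setminus\{a,b\}$; $\varepsilon\in\{0,1\}$. (6) $F$ is a single edge $ab$; the attachments of $y$ and $z$ are two distinct vertices of $X$ (both in $\{a,b\}$, or one in $\{a,b\}$ and one in $X\setminus\{a,b\}$, or both in $X\setminus\{a,b\}$); $\varepsilon=0$. (7) $F$ is a path $P_3$ on three vertices (two adjacent edges); attachments $(a',a')$, where $a'$ has degree one in $F$; $\varepsilon\in\{0,1\}$. (8) $F$ is $2K_2$ (two disjoint edges); attachments $(a',a')$, where $a'$ has degree one in $F$; $\varepsilon\in\{0,1\}$. *)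

(* Defs.v *)
From HB Require Import structures.
From mathcomp Require Import all_boot.

Set Implicit Arguments.
Unset Strict Implicit.
Unset Printing Implicit Defensive.

(* A finite simple graph on T is its symmetric, irreflexive set of adjacent
   ordered pairs, so that [graph T] is itself a finite type and two graphs on T
   are equal exactly when they have the same edges. *)
Definition is_graph (T : finType) (E : {set T * T}) : bool :=
  [forall x, (x, x) \notin E] &&
  [forall x, forall y, ((x, y) \in E) == ((y, x) \in E)].

Record graph (T : finType) : Type :=
  Graph { edges : {set T * T}; _ : is_graph edges }.

HB.instance Definition _ (T : finType) := [isSub for @edges T].
HB.instance Definition _ (T : finType) := [Finite of graph T by <:].

Definition adj (T : finType) (G : graph T) : rel T :=
  fun x y => (x, y) \in edges G.

(* Loops of r are discarded and r is symmetrized. *)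
Definition edges_of_rel (T : finType) (r : rel T) : {set T * T} :=
  [set p | (p.1 != p.2) && (r p.1 p.2 || r p.2 p.1)].

Lemma edges_of_rel_graph (T : finType) (r : rel T) : is_graph (edges_of_rel r).
Proof.
apply/andP; split; first by apply/forallP => x; rewrite inE /= eqxx.
apply/forallP => x; apply/forallP => y.
by rewrite !inE /= [y == x]eq_sym [r y x || _]orbC.
Qed.

Definition graph_of (T : finType) (r : rel T) : graph T :=
  Graph (edges_of_rel_graph r).

Lemma adj_graph_of (T : finType) (r : rel T) x y :
  adj (graph_of r) x y = (x != y) && (r x y || r y x).
Proof. by rewrite /adj inE. Qed.

Definition graph_of_edges (T : finType) (s : seq (T * T)) : graph T :=
  graph_of [rel x y | (x, y) \in s].

Definition degree (T : finType) (G : graph T) (x : T) : nat :=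
  #|[set y | adj G x y]|.

Definition compl_graph (T : finType) (G : graph T) : graph T :=
  graph_of [rel x y | ~~ adj G x y].

(* Not necessarily induced containment. *)
Definition contains (S T : finType) (H : graph S) (G : graph T) : bool :=
  [exists f : {ffun S -> T},
     injectiveb f &&
     [forall x, forall y, adj H x y ==> adj G (f x) (f y)]].

Definition isomorphic (S T : finType) (H : graph S) (G : graph T) : bool :=
  [exists f : {ffun S -> T},
     [&& injectiveb f, [forall z, z \in codom f] &
         [forall x, forall y, adj H x y == adj G (f x) (f y)]]].

(* The isomorphism class of G, as the set of its labelled copies on the fixed
   vertex set 'I_m.  It is meant to be used with m the order of G: for any
   other m it is empty. *)
Definition isoclass (m : nat) (T : finType) (G : graph T) : {set graph 'I_m} :=
  [set H : graph 'I_m | isomorphic H G].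

(* A cycle only for n >= 3. *)
Definition cycle_graph (n : nat) : graph 'I_n :=
  graph_of [rel i j | j == ordS i].

Definition complete_bipartite (m n : nat) : graph ('I_m + 'I_n)%type :=
  graph_of [rel u v | match u, v with
                      | inl _, inr _ => true
                      | _, _ => false
                      end].

Definition del_edge (T : finType) (G : graph T) (x y : T) : graph T :=
  graph_of [rel u v | adj G u v && ([set u; v] != [set x; y])].

Definition K55 : graph ('I_5 + 'I_5)%type := complete_bipartite 5 5.

(* All edges of K55 are equivalent under its automorphisms, so the choice of
   the removed one does not matter. *)
Definition K55_minus_edge : graph ('I_5 + 'I_5)%type :=
  del_edge K55 (inl ord0) (inr ord0).

Definition Hclasses (n : nat) : {set {set graph 'I_n.+1}} :=
  [set isoclass n.+1 H | H : graph 'I_n.+1 &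
     ~~ contains (cycle_graph n) H &&
     ~~ contains (cycle_graph 6) (compl_graph H)].

(* X is the left summand, y is [inr false] and z is [inr true]; F is the graph
   of blue edges on X, [ay] and [az] are the attachments, with [None] for
   bottom, and [eps] tells whether yz is red. *)
Definition attach_graph (r : nat) (F : graph 'I_r) (ay az : option 'I_r)
    (eps : bool) : graph ('I_r + bool)%type :=
  graph_of [rel u v | match u, v with
                      | inl a, inl b => ~~ adj F a b
                      | inr false, inl a => ay == Some a
                      | inr true, inl a => az == Some a
                      | inr _, inr _ => eps
                      | inl _, inr _ => false
                      end].

(* When F is a single edge, the position of the attachments relative to that
   edge is unrestricted, so it is not mentioned. *)
Definition permitted (r : nat) (F : graph 'I_r) (ay az : option 'I_r)
    (eps : bool) : bool :=
  [|| [&& F == graph_of_edges [::] &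
          [|| (ay, az) == (None, None),
              [exists a, (ay, az) == (Some a, None)] |
              [exists a, (ay, az) == (Some a, Some a)]]],
      [&& F == graph_of_edges [::],
          [exists a, exists b, (a != b) && ((ay, az) == (Some a, Some b))] &
          ~~ eps],
      [exists a, exists b,
         [&& a != b, F == graph_of_edges [:: (a, b)] &
             (ay, az) == (None, None)]],
      [exists a, exists b, exists a',
         [&& a != b, F == graph_of_edges [:: (a, b)] &
             (ay, az) == (Some a', None)]],
      [exists a, exists b, exists a',
         [&& a != b, F == graph_of_edges [:: (a, b)] &
             (ay, az) == (Some a', Some a')]],
      [exists a, exists b, exists a', exists b',
         [&& a != b, F == graph_of_edges [:: (a, b)], a' != b',
             (ay, az) == (Some a', Some b') & ~~ eps]],
      [exists a, exists b, exists c, exists a',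
         [&& uniq [:: a; b; c], F == graph_of_edges [:: (a, b); (b, c)],
             degree F a' == 1 & (ay, az) == (Some a', Some a')]] |
      [exists a, exists b, exists c, exists d, exists a',
         [&& uniq [:: a; b; c; d], F == graph_of_edges [:: (a, b); (c, d)],
             degree F a' == 1 & (ay, az) == (Some a', Some a')]]].

Definition Fclasses (r : nat) : {set {set graph 'I_r.+2}} :=
  [set isoclass r.+2 (attach_graph p.1.1.1 p.1.1.2 p.1.2 p.2)
    | p : graph 'I_r * option 'I_r * option 'I_r * bool
    & permitted p.1.1.1 p.1.1.2 p.1.2 p.2].

(* Main.v *)
Require Import Defs.
From mathcomp Require Import all_boot.

Set Implicit Arguments.
Unset Strict Implicit.
Unset Printing Implicit Defensive.

(** Read a graph as a colouring: its edges are red, those of its complement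
    blue.  Three sets of isomorphism classes include one another cyclically:
    the classes of colourings of the complete graph on n + 1 vertices without
    red [C_n] and blue [C_6], the classes of an explicit list of 24 (n = 8) or
    26 (n = 9) representatives, and the described family.

    The colourings are representatives because a colouring without blue [C_6]
    has long red cycles ([red_C7_or_C8], [red_C8]).  Some [C_4] is
    monochromatic, and while enough vertices lie outside it a red cycle grows,
    as otherwise those vertices send so many blue edges to it that a blue
    [C_6] appears; the growth may skip a length for parity reasons, as in
    complete bipartite graphs.  One thus gets a red cycle through all but two
    vertices.  Without red [C_n], a vertex outside it has no two red neighbours
    that are consecutive on the cycle, and few choices survive for the
    remaining edges.  Both the growth steps and this last enumeration are
    finite searches over partial colourings ([search]), whose soundness
    ([searchP]) is independent of the numbers; rotating the cycle so that a
    red edge leaving it, if any, is at its origin ([growsP]) keeps them small.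

    Conversely the members of the family have neither cycle, for all r > 2.
    A red cycle on r + 1 of the r + 2 vertices passes through y or z, whose two
    cycle neighbours are then its attachment and the other one of y and z;
    the common attachment closes a triangle ([attach_no_red_cycle]).  A blue
    [C_6] uses at least two edges of F, which forces the common attachment to
    be an end of one of them, and the cycle joins this end to y or z by a blue
    edge ([attach_no_blue_C6]).  The graph [K_{5,5}] is bipartite, and its
    complement is two copies of [K_5], joined by at most one edge.

    The representatives are pairwise non-isomorphic since the multiset of the
    numbers of walks of length two from each vertex distinguishes them
    ([isomorphic_profile]). *)

(** * Graphs and isomorphisms *)

Lemma adj_sym (T : finType) (G : graph T) : symmetric (adj G).
Proof.
move=> x y; case: G => E; rewrite /adj /= => /andP[_ /forallP h].
exact/eqP/(forallP (h x)).
Qed.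

Lemma adj_irr (T : finType) (G : graph T) x : adj G x x = false.
Proof. by case: G => E; rewrite /adj /= => /andP[/forallP/(_ x)/negbTE]. Qed.

Lemma adj_compl (T : finType) (G : graph T) x y :
  adj (compl_graph G) x y = (x != y) && ~~ adj G x y.
Proof. by rewrite adj_graph_of /= [adj G y x]adj_sym orbb. Qed.

Lemma graph_eqP (T : finType) (G H : graph T) : adj G =2 adj H -> G = H.
Proof. by move=> eGH; apply/val_inj/setP => -[x y]; apply: eGH. Qed.

Lemma compl_graphK (T : finType) : involutive (@compl_graph T).
Proof.
move=> G; apply: graph_eqP => x y; rewrite !adj_compl.
by case: eqVneq => [->|_] /=; rewrite ?adj_irr ?negbK.
Qed.

Lemma isomorphicP (S T : finType) (H : graph S) (G : graph T) :
  reflect (exists2 f : S -> T, bijective f &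
             forall x y, adj H x y = adj G (f x) (f y))
          (isomorphic H G).
Proof.
apply: (iffP existsP) => [[f /and3P[/injectiveP f_inj /forallP f_onto hom]]|].
  exists f; last by move=> x y; apply/eqP/(forallP (forallP hom x)).
  apply: inj_card_bij => //; rewrite -(card_codom f_inj).
  by apply/subset_leq_card/subsetP.
case=> f [g fK gK] hom; exists (finfun f); apply/and3P; split.
- by apply/injectiveP => x y; rewrite !ffunE => /(can_inj fK).
- by apply/forallP => z; apply/codomP; exists (g z); rewrite ffunE gK.
- by apply/forallP => x; apply/forallP => y; rewrite !ffunE hom.
Qed.

Lemma isomorphic_sym (S T : finType) (H : graph S) (G : graph T) :
  isomorphic H G -> isomorphic G H.
Proof.
case/isomorphicP=> f [g fK gK] hom; apply/isomorphicP; exists g.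
  by exists f.
by move=> x y; rewrite hom !gK.
Qed.

Lemma contains_iso (R S T : finType) (C : graph R) (H : graph S) (G : graph T) :
  isomorphic H G -> contains C H -> contains C G.
Proof.
case/isomorphicP=> f /bij_inj f_inj hom /existsP[h /andP[/injectiveP h_inj hh]].
apply/existsP; exists [ffun x => f (h x)]; apply/andP; split.
  by apply/injectiveP => x y; rewrite !ffunE => /f_inj/h_inj.
apply/forallP => x; apply/forallP => y; rewrite !ffunE -hom.
exact: (forallP (forallP hh x)).
Qed.

Lemma isomorphic_compl (S T : finType) (H : graph S) (G : graph T) :
  isomorphic H G -> isomorphic (compl_graph H) (compl_graph G).
Proof.
case/isomorphicP=> f f_bij hom; apply/isomorphicP; exists f => // x y.
by rewrite !adj_compl hom (inj_eq (bij_inj f_bij)).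
Qed.

Lemma isomorphic_trans (R S T : finType) (K : graph R) (H : graph S)
    (G : graph T) :
  isomorphic K H -> isomorphic H G -> isomorphic K G.
Proof.
move=> /isomorphicP[f f_bij hf] /isomorphicP[g g_bij hg].
apply/isomorphicP; exists (g \o f); first exact: bij_comp.
by move=> x y; rewrite hf hg.
Qed.

Lemma isomorphic_refl (T : finType) (G : graph T) : isomorphic G G.
Proof. by apply/isomorphicP; exists id => //; exists id. Qed.

Lemma isoclass_eq m (S T : finType) (H : graph S) (G : graph T) :
  isomorphic H G -> isoclass m H = isoclass m G.
Proof.
move=> HG; apply/setP => K; rewrite !inE; apply/idP/idP => KH.
  exact: isomorphic_trans HG.
exact: isomorphic_trans (isomorphic_sym HG).
Qed.

Lemma isoclass_inj m (H : graph 'I_m) (T : finType) (G : graph T) :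
  isoclass m H = isoclass m G -> isomorphic H G.
Proof. by move/setP/(_ H); rewrite !inE isomorphic_refl. Qed.

Lemma relabel (T : finType) (G : graph T) m :
  #|T| = m -> exists H : graph 'I_m, isomorphic H G.
Proof.
move <-; exists (graph_of [rel i j | adj G (enum_val i) (enum_val j)]).
apply/isomorphicP; exists enum_val; first exact: enum_val_bij.
move=> i j; rewrite adj_graph_of /= [adj G (enum_val j) _]adj_sym orbb.
by case: eqVneq => [->|]; rewrite ?adj_irr.
Qed.

(** * Cycles as sequences *)

Lemma cycle_nthP (T : Type) (e : rel T) x0 s :
  reflect (forall i, i < size s -> e (nth x0 s i) (nth x0 s (i.+1 %% size s)))
          (cycle e s).
Proof.
case: s => [|x p]; first by apply: ReflectT.
have nthE i : i <= size p ->
    nth x0 (x :: p) (i.+1 %% (size p).+1) = nth x0 (rcons p x) i.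
  rewrite leq_eqVlt nth_rcons => /predU1P[->|lt_i].
    by rewrite modnn ltnn eqxx.
  by rewrite modn_small ?ltnS // lt_i.
apply: (iffP (pathP x0)) => /= h i.
  rewrite ltnS => le_i; rewrite nthE //.
  have:= h i; rewrite size_rcons ltnS => /(_ le_i).
  by rewrite -rcons_cons nth_rcons /= ltnS le_i.
rewrite size_rcons => lt_i; have := h i lt_i; rewrite nthE //.
by rewrite -rcons_cons [nth _ (rcons (x :: p) x) i]nth_rcons /= lt_i.
Qed.

Lemma contains_cycleP (T : finType) (G : graph T) n : 2 < n ->
  reflect (exists s, [/\ size s = n, uniq s & cycle (adj G) s])
          (contains (cycle_graph n) G).
Proof.
move=> n_gt2; apply: (iffP existsP).
  case=> f /andP[/injectiveP f_inj /forallP hom].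
  have n_gt0 : 0 < n by apply: leq_trans n_gt2.
  pose i0 := Ordinal n_gt0.
  exists [seq f i | i <- enum 'I_n]; rewrite size_map size_enum_ord.
  split=> //; first by rewrite map_inj_uniq ?enum_uniq.
  apply/(cycle_nthP _ (f i0)); rewrite size_map size_enum_ord => i lt_i.
  have nthE j (lt_j : j < n) : nth (f i0) [seq f i | i <- enum 'I_n] j
      = f (Ordinal lt_j).
    rewrite (nth_map i0) ?size_enum_ord //; congr (f _).
    by apply: val_inj; rewrite /= nth_enum_ord.
  have lt_i' : i.+1 %% n < n by rewrite ltn_mod.
  rewrite !nthE; apply: (implyP (forallP (hom _) _)).
  rewrite adj_graph_of /=; apply/andP; split; last first.
    by apply/orP; left; rewrite -val_eqE /=.
  rewrite -val_eqE /=; have := lt_i; rewrite leq_eqVlt => /predU1P[eq_i|lt_Si].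
    by rewrite -eq_i modnn; case: (i) eq_i n_gt2 => // <-.
  by rewrite modn_small // neq_ltn ltnSn.
case=> s [sz_s s_uniq /cycle_nthP cyc_s].
have x0 : T by case: s sz_s {s_uniq cyc_s} => [|x] // sz; rewrite -sz in n_gt2.
exists [ffun i : 'I_n => nth x0 s i]; apply/andP; split.
  apply/injectiveP => i j; rewrite !ffunE => /eqP.
  by rewrite nth_uniq ?sz_s // => /eqP/val_inj.
apply/forallP => i; apply/forallP => j; apply/implyP.
rewrite adj_graph_of /= !ffunE => /andP[_ /orP[]/eqP->].
  by have := cyc_s x0 i; rewrite sz_s; apply.
by rewrite adj_sym; have := cyc_s x0 j; rewrite sz_s; apply.
Qed.

(** * Exhaustive search over partial colourings *)

(** Under call by value the Boolean connectives evaluate both sides; [any] and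
    the conditionals below stop as soon as the answer is known. *)
Fixpoint any T (a : pred T) s :=
  if s is x :: s' then if a x then true else any a s' else false.

Lemma anyE T (a : pred T) s : any a s = has a s.
Proof. by elim: s => //= x s ->; case: (a x). Qed.

Definition nbrs (m : seq (seq nat)) u := nth [::] m u.

Definition mark (used : bitseq) (w : nat) := set_nth false used w true.

(** A path with [l] edges from [u] to [v] whose inner vertices are not marked in
    [used]; [m] lists the neighbours of each vertex. *)
Fixpoint walk m l u v used :=
  match l with
  | 0 => false
  | 1 => any (eqn v) (nbrs m u)
  | l'.+1 => any (fun w => if nth false used w then false
                           else walk m l' w v (mark used w)) (nbrs m u)
  end.

(** The edge [uv] lies on a cycle of length [l].  The count is a cheap necessary
    condition: such a cycle needs [l] vertices of degree at least two. *)
Definition closes m l u v :=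
  (l <= count (fun s => 1 < size s) m) &&
  walk m l.-1 u v (mark (mark [::] u) v).

Definition link1 m u v := set_nth [::] m u (v :: nbrs m u).
Definition link m u v := link1 (link1 m u v) v u.

(** Decide the colours of the edges of [todo] in turn, [Some true] and
    [Some false] being imposed red and blue.  A branch ends when an edge closes
    a red cycle of a length in [lr] or a blue one of a length in [lb], and
    otherwise [test] must hold of the colouring obtained, given by its red and
    blue neighbour lists [r] and [b]. *)
Fixpoint search lr lb test (todo : seq (nat * nat * option bool)) r b :=
  if todo is (u, v, c) :: todo' then
    match c with
    | Some false => true
    | _ => let r' := link r u v in
           if any (fun l => closes r' l u v) lr then true
           else search lr lb test todo' r' b
    end &&
    match c with
    | Some true => true
    | _ => let b' := link b u v in
           if any (fun l => closes b' l u v) lb then true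
           else search lr lb test todo' r b'
    end
  else test r b.

(** The lists may be partial: only their entries are meaningful. *)
Definition records (e : rel nat) N m :=
  forall x y, y \in nbrs m x -> [&& x < N, y < N & e x y].

Definition no_cycle (e : rel nat) N l :=
  forall s, size s = l -> uniq s -> all (gtn N) s -> ~~ cycle e s.

Lemma nth_mark used w x :
  nth false (mark used w) x = (x == w) || nth false used x.
Proof. by rewrite nth_set_nth /=; case: eqP. Qed.

(** Only the soundness of [walk] matters, as a cycle that is overlooked prunes
    fewer branches. *)
Lemma walkP e N m l u v used :
  records e N m -> walk m l u v used ->
  exists q, [/\ l = (size q).+1, uniq q,
                all (fun w => (w < N) && ~~ nth false used w) q &
                path e u (rcons q v)].
Proof.
move=> rec_m; elim: l => [|[|l] IHl] //= in u used *; rewrite anyE.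
  case/hasP=> w w_u /eqP def_w; exists [::]; split=> //=.
  by rewrite andbT def_w; case/and3P: (rec_m _ _ w_u).
case/hasP=> w w_u; case: ifP => // used'w /IHl[q [-> q_uniq q_free e_q]].
have /and3P[_ lt_w e_uw] := rec_m _ _ w_u.
exists (w :: q); split=> //=; last by rewrite e_uw.
  rewrite q_uniq andbT; apply/negP => /(allP q_free).
  by rewrite nth_mark eqxx andbF.
rewrite lt_w used'w /=; apply/allP => x /(allP q_free) /andP[-> /=].
by rewrite nth_mark negb_or => /andP[].
Qed.

Lemma closesP e N m l u v :
    records e N m -> u < N -> v < N -> u != v -> e v u ->
  closes m l u v -> ~ no_cycle e N l.
Proof.
move=> rec_m lt_u lt_v neq_uv e_vu /andP[_ /(walkP rec_m)].
case=> q [def_l q_uniq q_free e_q] /(_ (u :: rcons q v)).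
have {def_l}def_l : l = (size q).+2 by case: l def_l => //= ? ->.
have outq x : (x \in [:: u; v]) -> x \notin q.
  rewrite !inE => xuv; apply/negP => /(allP q_free).
  by rewrite !nth_mark orbA [(x == v) || _]orbC xuv andbF.
have -> : size (u :: rcons q v) = l by rewrite /= size_rcons def_l.
have -> : uniq (u :: rcons q v).
  rewrite /= rcons_uniq q_uniq mem_rcons inE negb_or neq_uv.
  by rewrite !outq ?inE ?eqxx ?orbT.
have -> : all (gtn N) (u :: rcons q v).
  rewrite /= lt_u all_rcons /= lt_v; apply/allP => x /(allP q_free).
  by case/andP.
by move=> /(_ erefl isT isT); rewrite /= rcons_path e_q last_rcons e_vu.
Qed.

Lemma link_records e N m u v :
    symmetric e -> records e N m -> u < N -> v < N -> e u v ->
  records e N (link m u v).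
Proof.
move=> e_sym; have link1_records m' u' v' : records e N m' -> u' < N ->
    v' < N -> e u' v' -> records e N (link1 m' u' v').
  move=> rec_m lt_u lt_v e_uv x y; rewrite /nbrs nth_set_nth /=.
  case: eqP => [->|_]; last exact: rec_m.
  by rewrite inE => /predU1P[->|/rec_m //]; rewrite lt_u lt_v.
move=> rec_m lt_u lt_v e_uv; apply: (link1_records); rewrite // 1?e_sym //.
exact: link1_records.
Qed.

Section SearchSound.
Variables (N : nat) (eR eB : rel nat).
Hypotheses (eR_sym : symmetric eR) (eB_sym : symmetric eB).

Definition admits (i : nat * nat * option bool) :=
  let: (u, v, c) := i in
  [&& u < N, v < N, u != v &
      match c with
      | Some true => eR u v
      | Some false => eB u v
      | None => eR u v || eB u v
      end].

(** An actual colouring without the forbidden cycles follows one branch of the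
    search down to a leaf, since no recorded edge can close a forbidden cycle. *)
Lemma searchP lr lb test todo r b :
    {in lr, forall l, no_cycle eR N l} -> {in lb, forall l, no_cycle eB N l} ->
    all admits todo -> records eR N r -> records eB N b ->
    search lr lb test todo r b ->
  exists r' b', [/\ records eR N r', records eB N b' & test r' b'].
Proof.
move=> noR noB; elim: todo => [|[[u v] c] todo IH] /= in r b *.
  by move=> _ rec_r rec_b; exists r, b.
case/andP=> /and4P[lt_u lt_v neq_uv col_uv] adm rec_r rec_b /andP[].
have red : eR u v -> (if any (fun l => closes (link r u v) l u v) lr then true
    else search lr lb test todo (link r u v) b) ->
    exists r' b', [/\ records eR N r', records eB N b' & test r' b'].
  move=> e_uv; have rec_r' := link_records eR_sym rec_r lt_u lt_v e_uv.
  rewrite anyE; case: ifP => [/hasP[l /noR no_l] cl _|_]; last exact: IH.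
  by case: (closesP rec_r' lt_u lt_v neq_uv _ cl) => //; rewrite eR_sym.
have blue : eB u v -> (if any (fun l => closes (link b u v) l u v) lb then true
    else search lr lb test todo r (link b u v)) ->
    exists r' b', [/\ records eR N r', records eB N b' & test r' b'].
  move=> e_uv; have rec_b' := link_records eB_sym rec_b lt_u lt_v e_uv.
  rewrite anyE; case: ifP => [/hasP[l /noB no_l] cl _|_]; last exact: IH.
  by case: (closesP rec_b' lt_u lt_v neq_uv _ cl) => //; rewrite eB_sym.
case: c col_uv => [[]|].
- by move=> e_uv /(red e_uv) found _; apply: found.
- by move=> e_uv _ /(blue e_uv) found; apply: found.
- case/orP=> e_uv; first by move=> /(red e_uv) found _; apply: found.
  by move=> _ /(blue e_uv) found; apply: found.
Qed.

End SearchSound.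

(** * Colourings with a prescribed red cycle *)

Definition rim k := [seq (i, i.+1 %% k) | i <- iota 0 k].
Definition spokes n k := [seq (i, j) | j <- iota k (n - k), i <- iota 0 k].
Definition outer n k :=
  [seq (i, j) | i <- iota k (n - k), j <- iota i.+1 (n - i.+1)].
Definition chords k :=
  [seq e <- rev [seq (i, j) | j <- iota 0 k, i <- iota 0 j.-1] | e != (0, k.-1)].

Definition colour (c : option bool) (es : seq (nat * nat)) :=
  [seq (e, c) | e <- es].

(** The vertices [0], ..., [k - 1] form a red cycle, the others being [k], ...,
    [n - 1].  Either no red edge leaves the cycle, or by a rotation one joins
    [0] to [k]; [spoke] tells the two cases apart.  The order of the other edges
    only affects the size of the search tree. *)
Definition agenda n k (spoke : bool) :=
  colour (Some true) (rim k) ++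
  (if spoke then (0, k, Some true) :: colour None (behead (spokes n k))
   else colour (Some false) (spokes n k)) ++
  colour None (outer n k ++ chords k).

(** A colouring on [n] vertices with a red [C_k] and without blue [C_6] has a
    red cycle of a length in [lr] or satisfies [test]. *)
Definition grows n k lr test :=
  all (fun spoke => search lr [:: 6] test (agenda n k spoke) [::] [::])
      [:: true; false].

(** An injective list [L] of vertices transports a colouring to the numbers
    below its size. *)

Section Labelled.
Variables (T : finType) (G : graph T) (x0 : T) (L : seq T) (N : nat).
Hypotheses (L_uniq : uniq L) (le_N : N <= size L).

Let red : rel nat := relpre (nth x0 L) (adj G).
Let blue : rel nat := relpre (nth x0 L) (adj (compl_graph G)).

Lemma label_inj : {in gtn N &, injective (nth x0 L)}.
Proof.
move=> i j lt_i lt_j /eqP; rewrite nth_uniq ?(leq_trans _ le_N) //.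
by move/eqP.
Qed.

Lemma label_no_cycle (H : graph T) l :
  2 < l -> ~~ contains (cycle_graph l) H ->
  no_cycle (relpre (nth x0 L) (adj H)) N l.
Proof.
move=> l_gt2 noC s sz_s s_uniq /allP lt_s; apply: contra noC => cyc_s.
apply/contains_cycleP => //; exists (map (nth x0 L) s).
rewrite size_map cycle_map map_inj_in_uniq //.
by move=> i j /lt_s lt_i /lt_s lt_j; apply: label_inj.
Qed.

Lemma red_or_blue i j : i < N -> j < N -> i != j -> red i j || blue i j.
Proof.
move=> lt_i lt_j; rewrite /red /blue /= adj_compl; case: (adj _ _ _) => //=.
by rewrite andbT; apply: contra => /eqP/label_inj ->.
Qed.

Lemma search_labelled lr lb test todo :
    all (leq 3) (lr ++ lb) ->
    {in lr, forall l, ~~ contains (cycle_graph l) G} ->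
    {in lb, forall l, ~~ contains (cycle_graph l) (compl_graph G)} ->
    all (admits N red blue) todo -> search lr lb test todo [::] [::] ->
  exists r b, [/\ records red N r, records blue N b & test r b].
Proof.
rewrite all_cat => /andP[/allP lr3 /allP lb3] noR noB.
have [red_sym blue_sym] : symmetric red /\ symmetric blue.
  by split=> i j; apply: adj_sym.
move=> adm; apply: (searchP red_sym blue_sym _ _ adm) => [l lr_l|l lb_l|i j|i j].
- by apply: label_no_cycle (noR _ lr_l); apply: lr3.
- by apply: label_no_cycle (noB _ lb_l); apply: lb3.
- by rewrite /nbrs nth_nil.
- by rewrite /nbrs nth_nil.
Qed.

Lemma admits_free es :
  {in es, forall e, e.1 < e.2 < N} -> all (admits N red blue) (colour None es).
Proof.
move=> es_ok; rewrite all_map; apply/allP => -[i j] /es_ok /= /andP[lt_ij lt_j].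
have lt_i := ltn_trans lt_ij lt_j; rewrite lt_i lt_j neq_ltn lt_ij.
by rewrite red_or_blue // neq_ltn lt_ij.
Qed.

Lemma mem_spokes k e : e \in spokes N k -> [&& e.1 < k, k <= e.2 & e.2 < N].
Proof.
case/allpairsPdep=> j [i []]; rewrite !mem_iota /= => /andP[le_kj lt_j] lt_i -> /=.
by rewrite lt_i le_kj -(ltn_sub2rE _ le_kj) ltn_subLR.
Qed.

Lemma mem_outer k e : e \in outer N k -> e.1 < e.2 < N.
Proof.
case/allpairsPdep=> i [j []]; rewrite !mem_iota /= => _ /andP[lt_ij lt_j] -> /=.
by rewrite lt_ij -(ltn_sub2rE _ lt_ij) ltn_subLR.
Qed.

Lemma mem_chords k e : k <= N -> e \in chords k -> e.1 < e.2 < N.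
Proof.
move=> le_kN; rewrite mem_filter mem_rev => /andP[_ /allpairsPdep[j [i []]]].
rewrite !mem_iota /= => lt_j lt_i -> /=; rewrite (leq_trans lt_j le_kN) andbT.
exact: leq_trans lt_i (leq_pred j).
Qed.

End Labelled.

Lemma uniq_extend (T : finType) (p : seq T) :
  uniq p -> exists q, uniq (p ++ q) /\ size (p ++ q) = #|T|.
Proof.
move=> p_uniq; exists [seq x <- enum T | x \notin p].
have pq_uniq: uniq (p ++ [seq x <- enum T | x \notin p]).
  rewrite cat_uniq p_uniq filter_uniq ?enum_uniq // andbT.
  by apply/hasPn => x; rewrite mem_filter => /andP[].
split=> //; apply/eqP; rewrite -(card_uniqP pq_uniq); apply/eqP/eq_card => x.
by rewrite mem_cat mem_filter mem_enum andbT orbN.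
Qed.

(** A red cycle is listed first; if some outer vertex [w] has a red neighbour [x]
    on it, the cycle is rotated to begin with [x] and [w] is listed next. *)
Lemma growsP (T : finType) (G : graph T) x0 n k lr test :
    2 < k < n -> n <= #|T| -> all (leq 3) lr -> grows n k lr test ->
    contains (cycle_graph k) G -> ~~ contains (cycle_graph 6) (compl_graph G) ->
    {in lr, forall l, ~~ contains (cycle_graph l) G} ->
  exists L r b,
    [/\ uniq L, size L = #|T|,
        records (relpre (nth x0 L) (adj G)) n r,
        records (relpre (nth x0 L) (adj (compl_graph G))) n b & test r b].
Proof.
move=> /andP[k_gt2 lt_kn] le_nT lr3 /and3P[g_spoke g_nospoke _].
case/contains_cycleP=> // s [sz_s s_uniq cyc_s] noB noR.
have{noB} noB : {in [:: 6], forall l, ~~ contains (cycle_graph l) (compl_graph G)}.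
  by move=> l; rewrite inE => /eqP->.
have lrb3 : all (leq 3) (lr ++ [:: 6]) by rewrite all_cat lr3.
have le_kn := ltnW lt_kn; have k_gt0 : 0 < k by apply: leq_trans k_gt2.
have rim_ok s' q : size s' = k -> cycle (adj G) s' -> uniq (s' ++ q) ->
    n <= size (s' ++ q) ->
    all (admits n (relpre (nth x0 (s' ++ q)) (adj G))
            (relpre (nth x0 (s' ++ q)) (adj (compl_graph G))))
      (colour (Some true) (rim k)).
  move=> sz_s' /(cycle_nthP _ x0); rewrite sz_s' => cyc_s' s'q_uniq le_n.
  rewrite all_map all_map; apply/allP => i; rewrite mem_iota add0n /= => lt_i.
  have lt_i' : i.+1 %% k < k by rewrite ltn_mod.
  rewrite !(leq_trans _ le_kn) //= !nth_cat !sz_s' lt_i lt_i' cyc_s' // andbT.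
  rewrite neq_ltn; have := lt_i; rewrite leq_eqVlt => /predU1P[eq_i|lt_Si].
    by rewrite eq_i modnn -[0 < i]ltnS eq_i (ltnW k_gt2) orbT.
  by rewrite modn_small // ltnSn.
have free_ok L : uniq L -> n <= size L ->
    all (admits n (relpre (nth x0 L) (adj G))
            (relpre (nth x0 L) (adj (compl_graph G))))
      (colour None (outer n k ++ chords k)).
  move=> L_uniq le_nL; apply: admits_free => // e.
  by rewrite mem_cat => /orP[/mem_outer|/(mem_chords le_kn)].
case: (boolP [exists w, (w \notin s) && has (adj G w) s]).
  case/existsP=> w /andP[s'w /hasP[x s_x e_wx]].
  have [i s' def_s'] := rot_to s_x.
  have sz_s' : size (x :: s') = k by rewrite -def_s' size_rot.
  have [L [L_uniq sz_L L0 Lk rimL]] : exists L,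
      [/\ uniq L, size L = #|T|, nth x0 L 0 = x, nth x0 L k = w &
          all (admits n (relpre (nth x0 L) (adj G))
                 (relpre (nth x0 L) (adj (compl_graph G))))
              (colour (Some true) (rim k))].
    have /uniq_extend[q] : uniq (rcons (x :: s') w).
      by rewrite rcons_uniq -def_s' mem_rot s'w rot_uniq s_uniq.
    rewrite cat_rcons => -[L_uniq sz_L]; exists ((x :: s') ++ w :: q); split=> //.
      by rewrite nth_cat sz_s' ltnn subnn.
    by apply: rim_ok; rewrite ?sz_L // -def_s' rot_cycle.
  have le_nL : n <= size L by rewrite sz_L.
  have adm : all (admits n (relpre (nth x0 L) (adj G))
        (relpre (nth x0 L) (adj (compl_graph G)))) (agenda n k true).
    rewrite all_cat rimL /= (leq_trans k_gt0) // lt_kn neq_ltn k_gt0 /=.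
    rewrite L0 Lk adj_sym e_wx /= all_cat free_ok // andbT.
    apply: admits_free => // e /mem_behead/mem_spokes/and3P[lt_e le_e ->].
    by rewrite (leq_trans lt_e).
  have [r [b [rec_r rec_b rb_ok]]] :=
    search_labelled L_uniq le_nL lrb3 noR noB adm g_spoke.
  by exists L, r, b.
move=> /existsPn no_spoke; have [q [L_uniq sz_L]] := uniq_extend s_uniq.
have le_nL : n <= size (s ++ q) by rewrite sz_L.
have adm : all (admits n (relpre (nth x0 (s ++ q)) (adj G))
          (relpre (nth x0 (s ++ q)) (adj (compl_graph G))))
    (agenda n k false).
  rewrite all_cat rim_ok //= all_cat free_ok // andbT all_map.
  apply/allP => -[i j] /mem_spokes/and3P[/= lt_i le_j lt_j].
  rewrite (leq_trans lt_i) // lt_j neq_ltn (leq_trans lt_i) //=.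
  rewrite !nth_cat !sz_s lt_i ltnNge le_j /=.
  set w := nth x0 q _; set x := nth x0 s i.
  have s_x : x \in s by rewrite mem_nth ?sz_s.
  have s'w : w \notin s.
    move: L_uniq; rewrite cat_uniq => /and3P[_ /hasPn s'q _]; apply: s'q.
    by rewrite mem_nth // -(ltn_add2l k) subnKC // -sz_s -size_cat (leq_trans lt_j).
  have:= no_spoke w; rewrite s'w /= => /hasPn/(_ x s_x); rewrite adj_compl adj_sym.
  by move->; rewrite andbT; apply: contraNneq s'w => <-.
have [r [b [rec_r rec_b rb_ok]]] :=
  search_labelled L_uniq le_nL lrb3 noR noB adm g_nospoke.
by exists (s ++ q), r, b.
Qed.

(** * Long red cycles *)

Definition no_leaf (r b : seq (seq nat)) := false.

Lemma longer_cycle (T : finType) (G : graph T) n k lr :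
    grows n k lr no_leaf -> n <= #|T| -> 2 < k < n -> all (leq 3) lr ->
    ~~ contains (cycle_graph 6) (compl_graph G) ->
    contains (cycle_graph k) G ->
  exists2 l, l \in lr & contains (cycle_graph l) G.
Proof.
move=> grow le_nT lt_kn lr3 noB hasC.
case: (boolP (has (fun l => contains (cycle_graph l) G) lr)) => [/hasP //|].
move=> /hasPn noR; have /card_gt0P[x0 _] : 0 < #|T|.
  by case/andP: lt_kn => _ lt_kn; apply: leq_trans le_nT; apply: leq_trans lt_kn.
by have [L [r [b []]]] := growsP x0 lt_kn le_nT lr3 grow hasC noB noR.
Qed.

Lemma search_C4 : search [:: 4] [:: 4] no_leaf (colour None (outer 6 0)) [::] [::].
Proof. by vm_compute. Qed.

(** A red [C_4] need not grow into a [C_5], nor a red [C_6] into a [C_7], when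
    the red graph is complete bipartite. *)
Lemma grows_4 : grows 8 4 [:: 5; 6] no_leaf.
Proof. by vm_compute. Qed.

Lemma grows_5 : grows 8 5 [:: 6] no_leaf.
Proof. by vm_compute. Qed.

Lemma grows_6 : grows 9 6 [:: 7; 8] no_leaf.
Proof. by vm_compute. Qed.

Lemma grows_7 : grows 10 7 [:: 8] no_leaf.
Proof. by vm_compute. Qed.

Lemma red_or_blue_C4 (T : finType) (G : graph T) : 6 <= #|T| ->
  contains (cycle_graph 4) G \/ contains (cycle_graph 4) (compl_graph G).
Proof.
move=> le_6T; have /card_gt0P[x0 _] : 0 < #|T| by apply: leq_trans le_6T.
case: (boolP (contains (cycle_graph 4) G)) => [|noR]; first by left.
case: (boolP (contains (cycle_graph 4) (compl_graph G))) => [|noB]; first by right.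
have size_L : 6 <= size (enum T) by rewrite -cardE.
have no4 H : ~~ contains (cycle_graph 4) H ->
    {in [:: 4], forall l, ~~ @contains _ T (cycle_graph l) H}.
  by move=> noH l; rewrite inE => /eqP->.
have := @search_labelled _ G x0 _ 6 (enum_uniq T) size_L [:: 4] [:: 4] no_leaf
  (colour None (outer 6 0)) isT (no4 _ noR) (no4 _ noB) _ search_C4.
case=> [|r [b []] //]; apply: admits_free => //; first exact: enum_uniq.
exact: mem_outer.
Qed.

(** Applied to a graph or to its complement, whichever has a [C_4], this gives
    the Ramsey property [red_or_blue_C6]. *)
Lemma red_C4_C6 (T : finType) (G : graph T) :
    8 <= #|T| -> ~~ contains (cycle_graph 6) (compl_graph G) ->
  contains (cycle_graph 4) G -> contains (cycle_graph 6) G.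
Proof.
move=> le_8T noB; case/(longer_cycle grows_4 le_8T isT isT noB) => l.
rewrite !inE => /pred2P[]-> // C5.
by have [_ /[1!inE]/eqP->] := longer_cycle grows_5 le_8T isT isT noB C5.
Qed.

Lemma red_or_blue_C6 (T : finType) (G : graph T) : 8 <= #|T| ->
  contains (cycle_graph 6) G \/ contains (cycle_graph 6) (compl_graph G).
Proof.
move=> le_8T.
case: (boolP (contains (cycle_graph 6) G)) => [|noR]; first by left.
case: (boolP (contains (cycle_graph 6) (compl_graph G))) => [|noB]; first by right.
have le_6T : 6 <= #|T| by apply: leq_trans le_8T.
have [] := red_or_blue_C4 G le_6T.
  by move/(red_C4_C6 le_8T noB); rewrite (negbTE noR).
by move/(red_C4_C6 le_8T); rewrite compl_graphK (negbTE noB) => /(_ noR).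
Qed.

Lemma red_C7_or_C8 (T : finType) (G : graph T) :
    9 <= #|T| -> ~~ contains (cycle_graph 6) (compl_graph G) ->
  contains (cycle_graph 7) G \/ contains (cycle_graph 8) G.
Proof.
move=> le_9T noB; have [C6|C6] := red_or_blue_C6 G (ltnW le_9T).
  have [l] := longer_cycle grows_6 le_9T isT isT noB C6.
  by rewrite !inE => /pred2P[]->; [left | right].
by rewrite C6 in noB.
Qed.

Lemma red_C8 (T : finType) (G : graph T) :
    10 <= #|T| -> ~~ contains (cycle_graph 6) (compl_graph G) ->
  contains (cycle_graph 8) G.
Proof.
move=> le_10T noB; have [C7|//] := red_C7_or_C8 (ltnW le_10T) noB.
have [l] := longer_cycle grows_7 le_10T isT isT noB C7.
by rewrite inE => /eqP->.
Qed.

(** * Representatives *)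

(** The data [(F, ay, az, eps)] of a member of the family, with the vertices of X
    numbered from 0 and F given by a list of edges.  Since these use at most
    four vertices of X, the same patterns serve for all r > 3. *)
Definition pattern : Type := seq (nat * nat) * option nat * option nat * bool.
(** [inr minus] is [K_{5,5}], without an edge when [minus] holds. *)
Definition template : Type := (pattern + bool)%type.

(** The vertices y and z are 0 and 1, and those of X come next: y and z have few
    red edges, so that a placement is constrained from the start. *)
Definition tadj (t : template) (u v : nat) :=
  match t with
  | inl (F, ay, az, eps) =>
    match u, v with
    | 0, 1 | 1, 0 => eps
    | 0, i.+2 | i.+2, 0 => ay == Some i
    | 1, i.+2 | i.+2, 1 => az == Some i
    | i.+2, j.+2 => [&& i != j, (i, j) \notin F & (j, i) \notin F]
    | _, _ => false
    end
  | inr minus =>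
    ((u < 5) != (v < 5)) && ~~ (minus && (minn u v == 0) && (maxn u v == 5))
  end.

Definition model n (t : template) : graph 'I_n :=
  graph_of [rel i j : 'I_n | tadj t i j].

(** One representative for each choice of relative positions: the vertices 0 and
    1 are the ends of the single edge, and 2, 3 are away from it. *)
Definition patterns : seq pattern :=
  [seq (fa.1, fa.2.1, fa.2.2, eps) | eps <- [:: false; true],
     fa <- [:: ([::], (None, None)); ([::], (Some 0, None));
               ([::], (Some 0, Some 0));
               ([:: (0, 1)], (None, None)); ([:: (0, 1)], (Some 0, None));
               ([:: (0, 1)], (Some 2, None)); ([:: (0, 1)], (Some 0, Some 0));
               ([:: (0, 1)], (Some 2, Some 2));
               ([:: (0, 1); (1, 2)], (Some 0, Some 0));
               ([:: (0, 1); (2, 3)], (Some 0, Some 0))]] ++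
  [:: ([::], Some 0, Some 1, false); ([:: (0, 1)], Some 0, Some 1, false);
      ([:: (0, 1)], Some 0, Some 2, false); ([:: (0, 1)], Some 2, Some 3, false)].

Definition templates8 : seq template := map inl patterns.
Definition templates9 : seq template := map inl patterns ++ [:: inr false; inr true].

Definition tdegree t n u := count (tadj t u) (iota 0 n).

(** The list [p] holds the images of the vertices of the template that are
    already placed, the latest first; [w] is a candidate for vertex [j]. *)
Fixpoint fits t r b p j w :=
  if p is v :: p' then
    if any (eqn w) (nbrs (if tadj t j (size p') then r else b) v)
    then fits t r b p' j w else false
  else true.

(** A copy of the template [t] in a complete colouring, by backtracking.  The
    degree test only saves time. *)
Fixpoint place t n r b k p :=
  if k is k'.+1 then
    let d := tdegree t n (size p) in
    any (fun w => if eqn (size (nbrs r w)) d then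
                    if fits t r b p (size p) w
                    then place t n r b k' (w :: p) else false
                  else false) (iota 0 n)
  else true.

Definition matches ts n r b := any (fun t => place t n r b n [::]) ts.

Lemma grows_8 : grows 9 7 [:: 8] (matches templates8 9).
Proof. by vm_compute. Qed.

Lemma grows_9 : grows 10 8 [:: 9] (matches templates9 10).
Proof. by vm_compute. Qed.

Lemma tadj_sym t : symmetric (tadj t).
Proof.
case: t => [[[[F ay] az] eps]|minus] u v /=; last by rewrite eq_sym minnC maxnC.
by case: u v => [|[|i]] [|[|j]] //=; rewrite eq_sym [((i, j) \notin F) && _]andbC.
Qed.

Definition placed t r b q :=
  forall i j, i < j < size q ->
    nth 0 q j \in nbrs (if tadj t i j then r else b) (nth 0 q i).

Lemma fitsP t r b p j w : fits t r b p j w ->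
  forall i, i < size p ->
    w \in nbrs (if tadj t i j then r else b) (nth 0 (rev p) i).
Proof.
elim: p => //= v p IHp; rewrite anyE; case: ifP => // /hasP[x v_x /eqP def_x].
move=> {}/IHp IHp i; rewrite rev_cons nth_rcons size_rev ltnS leq_eqVlt.
by case: ltngtP => //= [lt_i _|-> _]; [apply: IHp | rewrite tadj_sym def_x].
Qed.

Lemma placeP t n r b k p :
  placed t r b (rev p) -> place t n r b k p ->
  exists2 q, size q = size p + k & placed t r b q.
Proof.
elim: k => [|k IHk] /= in p *.
  by exists (rev p); rewrite ?size_rev ?addn0.
move=> p_ok; rewrite anyE => /hasP[w _]; case: ifP => // _; case: ifP => // fit_w.
case/IHk=> [i j|q sz_q]; last by exists q; rewrite // sz_q addSnnS.
rewrite rev_cons size_rcons size_rev ltnS => /andP[lt_ij le_j].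
move: le_j lt_ij; rewrite !nth_rcons size_rev.
rewrite leq_eqVlt => /predU1P[->|lt_j] lt_i.
  by rewrite lt_i ltnn eqxx; apply: fitsP.
by rewrite (ltn_trans lt_i) // lt_j; apply: p_ok; rewrite size_rev lt_i.
Qed.

(** Any two placed vertices are joined by a recorded red or blue edge, whence the
    placement is injective. *)
Lemma placed_isomorphic (T : finType) (G : graph T) x0 L n t r b p :
    1 < n -> #|T| = n -> size p = n ->
    records (relpre (nth x0 L) (adj G)) n r ->
    records (relpre (nth x0 L) (adj (compl_graph G))) n b ->
  placed t r b p -> isomorphic G (model n t).
Proof.
move=> n_gt1 card_T sz_p rec_r rec_b p_ok; apply: isomorphic_sym.
pose f (i : 'I_n) := nth x0 L (nth 0 p i).
have lt_f (i j : 'I_n) : i < j ->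
    if tadj t i j then adj G (f i) (f j) else adj (compl_graph G) (f i) (f j).
  move=> lt_ij; have := p_ok i j; rewrite lt_ij sz_p ltn_ord => /(_ isT).
  by case: ifP => _; [case/rec_r/and3P | case/rec_b/and3P].
have f_neq (i j : 'I_n) : i < j -> f i != f j.
  move/lt_f; case: ifP => _; last by rewrite adj_compl => /andP[].
  by apply: contraTneq => ->; rewrite adj_irr.
have f_inj : injective f.
  move=> i j eq_f; apply: val_inj; case: (ltngtP i j) => // /f_neq.
    by rewrite eq_f eqxx.
  by rewrite eq_f eqxx.
have f_adj (i j : 'I_n) : i < j -> adj G (f i) (f j) = tadj t i j.
  move/lt_f; case: ifP => // _; rewrite adj_compl => /andP[_ /negbTE].
  done.
apply/isomorphicP; exists f; first by apply: inj_card_bij; rewrite // card_ord card_T.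
move=> i j; rewrite adj_graph_of /= [tadj t j i]tadj_sym orbb.
case: (ltngtP i j) => [lt_ij|lt_ji|/val_inj->]; last by rewrite eqxx adj_irr.
  by rewrite f_adj // -val_eqE neq_ltn lt_ij.
by rewrite adj_sym f_adj // tadj_sym -val_eqE neq_ltn lt_ji orbT.
Qed.

Lemma grows_isomorphic (T : finType) (G : graph T) n ts :
    grows n.+2 n [:: n.+1] (matches ts n.+2) -> #|T| = n.+2 -> 2 < n ->
    contains (cycle_graph n) G -> ~~ contains (cycle_graph n.+1) G ->
    ~~ contains (cycle_graph 6) (compl_graph G) ->
  exists2 t, t \in ts & isomorphic G (model n.+2 t).
Proof.
move=> grow card_T n_gt2 hasC noR noB.
have /card_gt0P[x0 _] : 0 < #|T| by rewrite card_T.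
have lt_n : 2 < n < n.+2 by rewrite n_gt2 leqnSn.
have le_nT : n.+2 <= #|T| by rewrite card_T.
have n3 : all (leq 3) [:: n.+1] by rewrite /= ltnS (ltnW n_gt2).
have [l|L [r [b [_ _ rec_r rec_b]]]] := growsP x0 lt_n le_nT n3 grow hasC noB.
  by rewrite inE => /eqP->.
rewrite /matches anyE => /hasP[t ts_t t_rb]; exists t => //.
have [|p sz_p p_ok] := placeP _ t_rb; first by move=> i j; rewrite andbF.
exact: placed_isomorphic sz_p rec_r rec_b p_ok.
Qed.

(** * Counting the representatives *)

Lemma tadj_irr t u : tadj t u u = false.
Proof.
case: t => [[[[F ay] az] eps]|minus] /=; last by rewrite eqxx.
by case: u => [|[|i]] //=; rewrite eqxx.
Qed.

Lemma adj_model n t (i j : 'I_n) : adj (model n t) i j = tadj t i j.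
Proof.
rewrite adj_graph_of /= [tadj t j i]tadj_sym orbb.
by case: eqVneq => // ->; rewrite tadj_irr.
Qed.

Fixpoint nwalks t n l u :=
  if l is l'.+1
  then sumn [seq (if tadj t u v then nwalks t n l' v else 0) | v <- iota 0 n]
  else 1.

(** Degree sequences would not suffice: for a single edge ab and eps = 0 they do
    not separate the attachments (a, a) from (a, c). *)
Definition profile n t := sort leq (map (nwalks t n 2) (iota 0 n)).

Lemma sumn_iota n F : sumn [seq F v | v <- iota 0 n] = \sum_(v < n) F v.
Proof. by rewrite sumnE big_map -{1}[n]subn0 big_mkord. Qed.

Lemma isomorphic_profile n t t' :
  isomorphic (model n t) (model n t') -> profile n t = profile n t'.
Proof.
case/isomorphicP=> f f_bij hom.
have nwalks_f l (i : 'I_n) : nwalks t n l i = nwalks t' n l (f i).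
  elim: l => //= l IHl in i *; rewrite !sumn_iota.
  rewrite [RHS](reindex f) /=; last exact: onW_bij.
  by apply: eq_bigr => j _; rewrite -IHl -!adj_model hom.
apply/perm_sortP; [exact: leq_total|exact: leq_trans|exact: anti_leq|].
rewrite -val_enum_ord -!(map_comp _ val (enum _)).
have -> : [seq (nwalks t n 2 \o val) i | i <- enum 'I_n]
    = [seq (nwalks t' n 2 \o val) i | i <- [seq f i | i <- enum 'I_n]].
  by rewrite -(map_comp _ f); apply: eq_map => i; apply: nwalks_f.
apply: perm_map; apply: uniq_perm;
  rewrite ?(map_inj_uniq (bij_inj f_bij)) ?enum_uniq //.
move=> i; rewrite mem_enum; have [g _ gK] := f_bij.
by rewrite -[i]gK map_f ?mem_enum.
Qed.

Lemma uniq_profile8 : uniq (map (profile 9) templates8).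
Proof. by vm_compute. Qed.

Lemma uniq_profile9 : uniq (map (profile 10) templates9).
Proof. by vm_compute. Qed.

Lemma uniq_map_coarser (S : eqType) (T U : eqType) (f : S -> T) (g : S -> U) s :
  (forall x y, f x = f y -> g x = g y) -> uniq (map g s) -> uniq (map f s).
Proof.
move=> fg; elim: s => //= x s IHs /andP[gx /IHs->]; rewrite andbT.
apply: contra gx => /mapP[y s_y /fg->]; exact: map_f.
Qed.

Lemma card_model_classes n ts : uniq (map (profile n) ts) ->
  #|[set C in [seq isoclass n (model n t) | t <- ts]]| = size ts.
Proof.
move=> ts_uniq; rewrite cardsE -(size_map (fun t => isoclass n (model n t))).
apply/card_uniqP; apply: uniq_map_coarser ts_uniq => t t'.
by move/isoclass_inj/isomorphic_profile.
Qed.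

(** * The representatives are permitted *)

Section Attach.
Variable r : nat.

Definition drawn (F : seq (nat * nat)) : graph 'I_r.+1 :=
  graph_of_edges [seq (inord e.1, inord e.2) | e <- F].

Definition fits_in (p : pattern) :=
  let: (F, ay, az, _) := p in
  [&& all (fun e => (e.1 <= r) && (e.2 <= r)) F,
      oapp (geq r) true ay & oapp (geq r) true az].

Definition attached (p : pattern) :=
  let: (F, ay, az, eps) := p in
  attach_graph (drawn F) (omap inord ay) (omap inord az) eps.

Lemma mem_drawn F (i j : 'I_r.+1) : all (fun e => (e.1 <= r) && (e.2 <= r)) F ->
  ((i, j) \in [seq (inord e.1, inord e.2) : 'I_r.+1 * 'I_r.+1 | e <- F])
  = ((val i, val j) \in F).
Proof.
elim: F => //= -[u v] F IHF /andP[/andP[le_u le_v] /IHF].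
by rewrite !inE !xpair_eqE -!val_eqE /= !inordK // => ->.
Qed.

Lemma attached_model p : fits_in p -> isomorphic (attached p) (model r.+3 (inl p)).
Proof.
case: p => [[[F ay] az] eps] /and3P[F_r ay_r az_r].
pose code (x : 'I_r.+1 + bool) : 'I_r.+3 :=
  match x with inl i => lift ord0 (lift ord0 i)
             | inr z => if z then lift ord0 ord0 else ord0 end.
have val_code i : val (code (inl i)) = i.+2 by [].
have code_inj : injective code.
  by move=> [i|[]] [j|[]] // /(congr1 val) //= [] /val_inj->.
have att (o : option nat) (i : 'I_r.+1) : oapp (geq r) true o ->
    (omap inord o == Some i) = (o == Some (val i)).
  case: o => //= u le_u; rewrite !(inj_eq Some_inj) -val_eqE /= inordK //.
apply/isomorphicP; exists code.
  by apply: inj_card_bij; rewrite // card_sum !card_ord card_bool addn2.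
move=> x y; rewrite adj_model adj_graph_of.
case: x => [i|[]]; case: y => [j|[]];
  rewrite ?val_code //= ?orbb ?orbF ?eqxx ?att //.
rewrite -[inl i == inl j]/(i == j) [adj _ j i]adj_sym orbb adj_graph_of /=.
by rewrite !mem_drawn // -val_eqE /= !negb_and !negb_or; case: (_ == _ :> nat).
Qed.

End Attach.

Lemma degree1 (T : finType) (G : graph T) x y :
  adj G x =1 pred1 y -> degree G x = 1.
Proof.
move=> adjE; rewrite -(cards1 y); apply: eq_card => z.
by rewrite !inE; apply: adjE.
Qed.

Lemma inord_neq r a b : a < 4 -> b < 4 -> a != b ->
  (inord a : 'I_r.+4) != inord b.
Proof. by move=> lt_a lt_b; rewrite -val_eqE /= !inordK // (@leq_trans 4). Qed.

Lemma permitted_patterns r :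
  all (fun p => let: (F, ay, az, eps) := p in
         permitted (drawn r.+3 F) (omap inord ay) (omap inord az) eps) patterns.
Proof.
have neq a b : a < 4 -> b < 4 -> a != b -> (inord a : 'I_r.+4) != inord b.
  exact: inord_neq.
have none0 eps : permitted (drawn r.+3 [::]) None None eps.
  by apply/orP; left; rewrite /drawn !eqxx.
have none1 a eps : permitted (drawn r.+3 [::]) (Some a) None eps.
  apply/orP; left; rewrite /drawn eqxx; apply/or3P/Or32.
  by apply/existsP; exists a.
have none11 a eps : permitted (drawn r.+3 [::]) (Some a) (Some a) eps.
  apply/orP; left; rewrite /drawn eqxx; apply/or3P/Or33.
  by apply/existsP; exists a.
have none2 : permitted (drawn r.+3 [::]) (Some (inord 0)) (Some (inord 1)) false.
  apply/orP; right; apply/orP; left; rewrite /drawn eqxx andbT /=.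
  by apply/existsP; exists (inord 0); apply/existsP; exists (inord 1); rewrite neq /=.
have edge0 eps : permitted (drawn r.+3 [:: (0, 1)]) None None eps.
  do 2![apply/orP; right]; apply/orP; left.
  apply/existsP; exists (inord 0); apply/existsP; exists (inord 1).
  by rewrite /drawn /= neq // !eqxx.
have edge1 a eps : permitted (drawn r.+3 [:: (0, 1)]) (Some a) None eps.
  do 3![apply/orP; right]; apply/orP; left.
  apply/existsP; exists (inord 0); apply/existsP; exists (inord 1).
  by apply/existsP; exists a; rewrite /drawn /= neq // !eqxx.
have edge11 a eps : permitted (drawn r.+3 [:: (0, 1)]) (Some a) (Some a) eps.
  do 4![apply/orP; right]; apply/orP; left.
  apply/existsP; exists (inord 0); apply/existsP; exists (inord 1).
  by apply/existsP; exists a; rewrite /drawn /= neq // !eqxx.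
have edge2 a b : a < 4 -> b < 4 -> a != b ->
    permitted (drawn r.+3 [:: (0, 1)]) (Some (inord a)) (Some (inord b)) false.
  move=> lt_a lt_b neq_ab; do 5![apply/orP; right]; apply/orP; left.
  apply/existsP; exists (inord 0); apply/existsP; exists (inord 1).
  apply/existsP; exists (inord a); apply/existsP; exists (inord b).
  by rewrite /drawn /= !neq // !eqxx.
have path eps :
    permitted (drawn r.+3 [:: (0, 1); (1, 2)]) (Some (inord 0)) (Some (inord 0)) eps.
  do 6![apply/orP; right]; apply/orP; left.
  apply/existsP; exists (inord 0); apply/existsP; exists (inord 1).
  apply/existsP; exists (inord 2); apply/existsP; exists (inord 0).
  rewrite /drawn /= !inE !negb_or !neq // !eqxx /= andbT.
  apply/eqP/(@degree1 _ _ _ (inord 1)) => x; rewrite adj_graph_of /= !inE !xpair_eqE.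
  rewrite eqxx /= (negbTE (neq 0 1 _ _ _)) //= (negbTE (neq 0 2 _ _ _)) //=.
  rewrite !andbF !orbF.
  by case: (x =P inord 1) => [->|]; rewrite ?andbF ?andbT ?neq.
have pair eps :
    permitted (drawn r.+3 [:: (0, 1); (2, 3)]) (Some (inord 0)) (Some (inord 0)) eps.
  do 7![apply/orP; right].
  apply/existsP; exists (inord 0); apply/existsP; exists (inord 1).
  apply/existsP; exists (inord 2); apply/existsP; exists (inord 3).
  apply/existsP; exists (inord 0).
  rewrite /drawn /= !inE !negb_or !neq // !eqxx /= andbT.
  apply/eqP/(@degree1 _ _ _ (inord 1)) => x; rewrite adj_graph_of /= !inE !xpair_eqE.
  rewrite eqxx /= (negbTE (neq 0 1 _ _ _)) //= (negbTE (neq 0 2 _ _ _)) //=.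
  rewrite (negbTE (neq 0 3 _ _ _)) //= !andbF !orbF.
  by case: (x =P inord 1) => [->|]; rewrite ?andbF ?andbT ?neq.
rewrite /patterns /= !none0 !none1 !none11 !none2 !edge0 !edge1 !edge11 !path !pair.
by rewrite !edge2.
Qed.

(** * The permitted graphs contain neither cycle *)

Lemma adj_two_edges (T : finType) (e f : T * T) x y :
  adj (graph_of_edges [:: e; f]) x y ->
  (x, y) \in [:: e; (e.2, e.1); f; (f.2, f.1)].
Proof.
case: e f => [a b] [c d]; rewrite adj_graph_of /= !inE !xpair_eqE => /andP[_].
by case/orP=> /orP[] /andP[/eqP-> /eqP->]; rewrite !eqxx ?orbT.
Qed.

Lemma degree1_uniq (T : finType) (G : graph T) x y z :
  degree G x = 1 -> adj G x y -> adj G x z -> y = z.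
Proof.
move/eqP/cards1P=> [w def_w] xy xz.
have : y \in [set v | adj G x v] by rewrite inE.
have : z \in [set v | adj G x v] by rewrite inE.
by rewrite def_w !inE => /eqP-> /eqP->.
Qed.

Lemma degree1_adj (T : finType) (G : graph T) x :
  degree G x = 1 -> exists y, adj G x y.
Proof.
by move/eqP/cards1P=> [w /setP/(_ w)]; rewrite !inE eqxx; exists w.
Qed.

Lemma cycle_from (T : eqType) (e : rel T) s x :
    x \in s -> uniq s -> cycle e s ->
  exists s', [/\ size s = (size s').+1, uniq (x :: s') & cycle e (x :: s')].
Proof.
case/rot_to=> i s' def_s s_uniq cyc_s; exists s'.
rewrite -[(size s').+1]/(size (x :: s')) -def_s.
by rewrite size_rot rot_uniq rot_cycle.
Qed.

Lemma no_inr (T U : eqType) (s : seq (T + U)) :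
  (forall u, inr u \notin s) -> exists s', s = map inl s'.
Proof.
elim: s => [|[t|u] s IHs] noR; first by exists [::].
  have [u|s' ->] := IHs; last by exists (t :: s').
  by have := noR u; rewrite inE negb_or => /andP[].
by have := noR u; rewrite mem_head.
Qed.

Section AttachCycles.
Variables (r : nat) (F : graph 'I_r) (ay az : option 'I_r) (eps : bool).
Hypothesis ok : permitted F ay az eps.

Let att (z : bool) := if z then az else ay.

Lemma permitted_red_yz a b : eps -> ay = Some a -> az = Some b -> a = b.
Proof.
move=> eps_t def_ay def_az; move: ok; rewrite def_ay def_az eps_t /permitted.
case/or4P=> [/andP[_]|/and3P[_ _ //]| |].
- case/or3P=> [//|/existsP[x]|/existsP[x]]; rewrite xpair_eqE.
    by rewrite andbC.
  by case/andP=> /eqP[->] /eqP[->].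
- by do 2!case/existsP=> ?; case/and3P.
case/or4P=> [|||/orP[]].
- by do 3!case/existsP=> ?; case/and3P=> _ _; rewrite xpair_eqE andbC.
- by do 3!case/existsP=> ?; case/and3P=> _ _ /eqP[-> ->].
- by do 4!case/existsP=> ?; case/and5P.
- by do 4!case/existsP=> ?; case/and4P=> _ _ _ /eqP[-> ->].
by do 5!case/existsP=> ?; case/and4P=> _ _ _ /eqP[-> ->].
Qed.

(** The only information on F that matters for blue cycles: two edges are all
    of F, and then y and z are attached to the same end of one of them. *)
Lemma permitted_two_edges a b c d :
    adj F a b -> adj F c d -> (c, d) \notin [:: (a, b); (b, a)] ->
  exists x, [/\ ay = Some x, az = Some x, degree F x = 1, x \in [:: a; b; c; d] &
    forall u v, adj F u v -> (u, v) \in [:: (a, b); (b, a); (c, d); (d, c)]].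
Proof.
move=> Fab Fcd ncd.
have noF : F != graph_of_edges [::].
  by apply: contraTneq Fab => ->; rewrite adj_graph_of andbF.
have no1 u v : F != graph_of_edges [:: (u, v)].
  apply: contraTneq ncd => def_F; move: Fab Fcd; rewrite def_F !adj_graph_of /=.
  rewrite !inE !xpair_eqE.
  move=> /andP[_ /orP[]/andP[/eqP-> /eqP->]] /andP[_ /orP[]/andP[/eqP-> /eqP->]];
    by rewrite !eqxx ?orbT.
have key e f x : F = graph_of_edges [:: e; f] -> degree F x = 1 ->
    ay = Some x -> az = Some x ->
    exists x, [/\ ay = Some x, az = Some x, degree F x = 1, x \in [:: a; b; c; d] &
      forall u v, adj F u v -> (u, v) \in [:: (a, b); (b, a); (c, d); (d, c)]].
  move=> def_F deg_x ay_x az_x; exists x.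
  have all_edges u v : adj F u v -> (u, v) \in [:: (a, b); (b, a); (c, d); (d, c)].
    move: Fab Fcd; rewrite def_F => /adj_two_edges ab /adj_two_edges cd /adj_two_edges.
    move: ab cd ncd; case: e f {def_F} => [e1 e2] [f1 f2] /=; rewrite !inE !xpair_eqE.
    by case/or4P=> /andP[/eqP-> /eqP->]; case/or4P=> /andP[/eqP-> /eqP->];
      rewrite ?eqxx ?orbT //= => _ /or4P[]/andP[/eqP-> /eqP->]; rewrite !eqxx ?orbT.
  split=> //; have [y /all_edges] := degree1_adj deg_x.
  by rewrite !inE !xpair_eqE => /or4P[]/andP[/eqP-> _]; rewrite eqxx ?orbT.
move: ok; rewrite /permitted (negbTE noF) /=.
have no1b u v : (F == graph_of_edges [:: (u, v)]) = false by apply/negbTE.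
case/or4P=> [||| /or3P[]].
- by do 2!case/existsP=> ?; rewrite no1b andbF.
- by do 3!case/existsP=> ?; rewrite no1b andbF.
- by do 3!case/existsP=> ?; rewrite no1b andbF.
- by do 4!case/existsP=> ?; rewrite no1b andbF.
- do 4!case/existsP=> ?; case/and4P=> _ /eqP def_F /eqP deg_x /eqP[ay_x az_x].
  exact: key def_F deg_x ay_x az_x.
do 5!case/existsP=> ?; case/and4P=> _ /eqP def_F /eqP deg_x /eqP[ay_x az_x].
exact: key def_F deg_x ay_x az_x.
Qed.

Let G := attach_graph F ay az eps.

Lemma red_attach w x : adj G (inr w) x ->
  x = inr (~~ w) /\ eps \/ exists2 a, x = inl a & att w = Some a.
Proof.
rewrite adj_graph_of /=; case: x => [a|w'] /=.
  by case: w => /=; rewrite orbF => /eqP; right; exists a.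
by case: w w' => [] [] //=; rewrite orbb; left.
Qed.

(** Some [w] among y and z lies on the cycle, written w, b, c, ..., d.  Its only
    possible neighbours are its attachment and the other one of y and z, so b
    and d are these two; the latter, if it is b, has neighbours w and c, and c
    must be the common attachment d (symmetrically if it is d). *)
Lemma attach_no_red_cycle : 2 < r -> ~~ contains (cycle_graph r.+1) G.
Proof.
move=> r_gt2; apply/contains_cycleP; first exact: ltnW.
case=> s [sz_s s_uniq cyc_s].
have [w s_w] : exists w, inr w \in s.
  case: (boolP (has (fun x => if x is inr _ then true else false) s)).
    by case/hasP=> -[//|w] s_w _; exists w.
  move/hasPn=> no_r; suff : size s <= r by rewrite sz_s ltnn.
  have := @uniq_leq_size _ s (map inl (enum 'I_r)) s_uniq.
  rewrite size_map size_enum_ord; apply=> -[a|w] /no_r // _.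
  by rewrite map_f ?mem_enum.
have [s' [sz_s']] := cycle_from s_w s_uniq cyc_s.
have {sz_s sz_s'} : 2 < size s' by move: sz_s'; rewrite sz_s => -[<-].
case: s' => [|b [|c t]] //; case/lastP: t => // t d _.
rewrite /= !rcons_path last_rcons !inE !mem_rcons !inE rcons_uniq !negb_or.
case/and3P=> /and4P[_ wc wd wt] /and3P[bc bd bt] /andP[/andP[cd ct] /andP[dt t_uniq]].
case/and3P=> wb Gbc /andP[/andP[path_t ed] dw].
rewrite adj_sym in dw; rewrite adj_sym in ed.
have last_ct v : v != c -> v \notin t -> v != last c t.
  move=> vc vt; apply: contraNneq vt => def_v; have := mem_last c t.
  by rewrite -def_v inE (negbTE vc).
have att_eq a x : eps -> att w = Some a -> att (~~ w) = Some x -> x = a.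
  case: (w) => /= eps1 aw anw; first exact: permitted_red_yz anw aw.
  exact: esym (permitted_red_yz eps1 aw anw).
case: (red_attach wb) => [[def_b eps1]|[a def_b att_w]];
  case: (red_attach dw) => [[def_d eps1']|[a' def_d att_w']].
- by rewrite def_b def_d eqxx in bd.
- rewrite def_b in Gbc; case: (red_attach Gbc) => [[def_c _]|[x def_c att_w'']].
    by rewrite def_c negbK eqxx in wc.
  by rewrite def_c def_d (att_eq _ _ eps1 att_w' att_w'') eqxx in cd.
- rewrite def_d in ed; have [[def_e _]|[x def_e att_w'']] := red_attach ed.
    by have := last_ct _ wc wt; rewrite def_e negbK eqxx.
  have := last_ct _ bc bt; rewrite def_e def_b.
  by rewrite (att_eq _ _ eps1' att_w att_w'') eqxx.
by move: bd; rewrite def_b def_d; move: att_w'; rewrite att_w => -[->]; rewrite eqxx.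
Qed.

Lemma blue_spoke w a : adj (compl_graph G) (inr w) (inl a) = (att w != Some a).
Proof. by rewrite adj_compl adj_graph_of /=; case: w; rewrite /= orbF. Qed.

Lemma blue_inl a b : adj (compl_graph G) (inl a) (inl b) -> adj F a b.
Proof.
rewrite adj_compl adj_graph_of /= [adj F b a]adj_sym orbb.
by case: (_ == _); rewrite //= negbK.
Qed.

Lemma no_blue_path a b c d :
  a != c -> b != d -> adj F a b -> adj F b c -> adj F c d -> False.
Proof.
move=> ac bd Fab Fbc Fcd.
have neq x y : adj F x y -> x != y by apply: contraTneq => ->; rewrite adj_irr.
have [|x [_ _ _ _ /(_ c d Fcd)]] := permitted_two_edges Fab Fbc.
  by rewrite !inE !xpair_eqE ![_ == a]eq_sym (negbTE ac) (negbTE (neq _ _ Fab)) !andbF.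
rewrite !inE !xpair_eqE ![c == _]eq_sym ![d == _]eq_sym (negbTE ac) (negbTE bd).
by rewrite (negbTE (neq _ _ Fbc)) !andbF.
Qed.

Lemma blue_two_edges a b c d :
    adj F a b -> adj F c d -> (c, d) \notin [:: (a, b); (b, a)] ->
  exists2 x, x \in [:: a; b; c; d] /\ degree F x = 1 & forall w, att w = Some x.
Proof.
move=> Fab Fcd /(permitted_two_edges Fab Fcd)[x [ay_x az_x deg_x abcd_x _]].
by exists x => // -[].
Qed.

(** By the position of y and z on the cycle: if it misses one of them, or if they
    are consecutive, it has three consecutive edges of F, too many.  If they
    are at distance two or three, it has two edges of F, and all their ends but
    the middle of a path, which has degree two in F, are joined to y or z by
    blue edges of the cycle; so none is the common attachment. *)
Lemma attach_no_blue_C6 : ~~ contains (cycle_graph 6) (compl_graph G).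
Proof.
apply/contains_cycleP => // -[s [sz_s s_uniq cyc_s]].
(* y and z at distance two on the cycle *)
have near w a b c : a != c -> adj F a b -> adj F b c ->
    att w != Some a -> att (~~ w) != Some c -> False.
  move=> ac Fab Fbc wa wc; have [|x [x_in deg_x] att_x] := blue_two_edges Fab Fbc.
    rewrite !inE !xpair_eqE [c == a]eq_sym (negbTE ac) andbF orbF.
    by apply: contraTN Fab => /andP[/eqP-> _]; rewrite adj_irr.
  move: x_in wa wc; rewrite !att_x !inE => /or4P[]/eqP def_x; rewrite -?def_x ?eqxx //;
    by move: ac;
      rewrite (degree1_uniq deg_x (y := a) (z := c)) ?eqxx // def_x // adj_sym.
(* y and z at distance three *)
have far w a b c d : adj F a b -> adj F c d -> uniq [:: a; b; c; d] ->
    att w != Some a -> att (~~ w) != Some b -> att (~~ w) != Some c ->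
    att w != Some d -> False.
  move=> Fab Fcd abcd wa wb wc wd.
  have [|x [x_in _] att_x] := blue_two_edges Fab Fcd.
    move: abcd; rewrite /= !inE !xpair_eqE !negb_or !negb_and.
    case/and3P=> /and3P[_ ac ad] /andP[bc bd] _.
    by rewrite ![c == _]eq_sym ac bc.
  by move: x_in wa wb wc wd; rewrite !att_x !inE => /or4P[]/eqP->; rewrite eqxx.
have red_path a b c d t : adj F a b -> adj F b c -> adj F c d ->
    uniq [:: a, b, c, d & t] -> False.
  move=> Fab Fbc Fcd; rewrite /= !inE !negb_or.
  move=> /and3P[/and4P[_ ac _ _] /and3P[_ bd _] _].
  exact: no_blue_path ac bd Fab Fbc Fcd.
case: (boolP [exists w, inr w \in s]);
  [case/existsP=> w s_w | move/existsPn/no_inr=> [p def_s]]; last first.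
  move: sz_s s_uniq cyc_s; rewrite def_s size_map (map_inj_uniq inl_inj).
  case: p {s def_s} => [|a [|b [|c [|d [|e [|f []]]]]]] // _ p_uniq.
  move=> /= /and5P[/blue_inl Fab /blue_inl Fbc /blue_inl Fcd _ _].
  exact: red_path p_uniq.
have [s' [sz_s' {}s_uniq {}cyc_s]] := cycle_from s_w s_uniq cyc_s.
move: sz_s'; rewrite {}sz_s => -[] {s s_w}.
have s'w : inr w \notin s' by case/andP: s_uniq.
case: (boolP (inr (~~ w) \in s')) => [|s'z]; last first.
  have [|p def_s'] := @no_inr _ _ s'; first by case: (w) s'w s'z => ? ? [].
  move: s_uniq cyc_s; rewrite def_s' cons_uniq (map_inj_uniq inl_inj) size_map.
  case: p {def_s' s'w s'z} => [|a [|b [|c [|d [|e []]]]]] // /andP[_ p_uniq].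
  move=> /= /and5P[_ /blue_inl Fab /blue_inl Fbc /blue_inl Fcd _] _.
  exact: red_path p_uniq.
move=> s'z; case/splitPr: s'z s_uniq cyc_s s'w => p q.
rewrite cons_uniq -(cat1s (inr (~~ w))) uniq_catCA cat1s cons_uniq mem_cat => /and3P[_].
rewrite !(mem_cat, inE) !negb_or.
move=> /andP[p'z q'z] pq_uniq cyc_s /and3P[p'w _ q'w] sz_pq.
have [|p' def_p] := @no_inr _ _ p; first by case: (w) p'w p'z => ? ? [].
have [|q' def_q] := @no_inr _ _ q; first by case: (w) q'w q'z => ? ? [].
move: pq_uniq cyc_s sz_pq; rewrite {p p'w p'z}def_p {q q'w q'z}def_q -map_cat.
rewrite (map_inj_uniq inl_inj) size_cat /= !size_map.
case: p' => [|a [|b [|c [|d p]]]].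
- case: q' => [|a [|b [|c [|d []]]]] // abcd.
  move=> /= /and5P[_ _ /blue_inl Fab /blue_inl Fbc /andP[/blue_inl Fcd _]] _.
  exact: red_path abcd.
- case: q' => [|b [|c [|d []]]] // abcd.
  move=> /= /and5P[_ _ zb /blue_inl Fbc /and3P[/blue_inl Fcd dw _]] _.
  rewrite blue_spoke in zb; rewrite adj_sym blue_spoke in dw.
  apply: (near (~~ w) b c d); rewrite ?negbK //.
  by move: abcd; rewrite /= !inE !negb_or => /and3P[_ /andP[_ ->]].
- case: q' => [|c [|d []]] // abcd.
  move=> /= /and5P[wa /blue_inl Fab bz zc /and3P[/blue_inl Fcd dw _]] _.
  rewrite blue_spoke in wa; rewrite adj_sym blue_spoke in bz.
  rewrite blue_spoke in zc; rewrite adj_sym blue_spoke in dw.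
  exact: (far w a b c d).
- case: q' => [|d []] // abcd.
  move=> /= /and5P[wa /blue_inl Fab /blue_inl Fbc cz _] _.
  rewrite blue_spoke in wa; rewrite adj_sym blue_spoke in cz.
  apply: (near w a b c) => //.
  by move: abcd; rewrite /= !inE !negb_or => /and3P[/and3P[_ ->]].
- case: q' p => [|? q'] [|? p] abcd; rewrite /= ?addn1 ?addnS //.
  move=> /and5P[_ /blue_inl Fab /blue_inl Fbc /blue_inl Fcd _] _.
  exact: red_path abcd.
Qed.

End AttachCycles.

(** * The bipartite graphs *)

Section K55.
Variable minus : bool.

Notation V := ('I_5 + 'I_5)%type.

Definition near_K55 : graph V := if minus then K55_minus_edge else K55.

Let side (u : V) := if u is inl _ then false else true.
Let gap (u v : V) := [&& minus, u == inl ord0 & v == inr ord0].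

Lemma adj_near_K55 u v :
  adj near_K55 u v = (side u != side v) && ~~ (gap u v || gap v u).
Proof.
have adjE x y : adj K55 x y = (side x != side y).
  by rewrite adj_graph_of; case: x y => [i|i] [j|j]; rewrite /= ?andbF.
have gapE (i j : 'I_5) :
    ([set inl i; inr j] == [set inl ord0; inr ord0] :> {set V})
    = (i == ord0) && (j == ord0).
  rewrite eqEsubset !subUset !sub1set !inE orbF /=.
  have inlE (x y : 'I_5) : (inl x == inl y :> V) = (x == y) by [].
  have inrE (x y : 'I_5) : (inr x == inr y :> V) = (x == y) by [].
  by rewrite !inlE !inrE !orbF ![ord0 == _]eq_sym andbb.
rewrite /near_K55 /gap; case: ifP => _; last by rewrite adjE andbT.
rewrite adj_graph_of /= !adjE; case: u v => [i|i] [j|j]; rewrite //= ?andbF //.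
  by rewrite [[set inr j; inl i]]setUC gapE orbb orbF.
by rewrite [[set inr i; inl j]]setUC gapE orbb.
Qed.

Lemma near_K55_model : isomorphic near_K55 (model 10 (inr minus)).
Proof.
apply/isomorphicP; exists (@unsplit 5 5).
  by exists (@split 5 5); [exact: unsplitK | exact: splitK].
move=> u v; rewrite adj_near_K55 adj_model /gap /=.
have lt5 (u' : V) : (unsplit u' < 5) = ~~ side u'.
  by case: u' => i /=; rewrite ?ltn_ord // ltnNge leq_addr.
have gapE (i j : 'I_5) :
    (minn i (5 + j) == 0) && (maxn i (5 + j) == 5) = (i == ord0) && (j == ord0).
  have lt_ij : i < 5 + j by apply: ltn_addr.
  by rewrite /minn /maxn lt_ij -{2}[5]addn0 eqn_add2l -!val_eqE.
rewrite !lt5; case: u v => [i|i] [j|j] //=; rewrite -andbA.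
  by rewrite gapE !andbF orbF.
by rewrite minnC maxnC gapE andbF.
Qed.

Lemma near_K55_no_red_C9 : ~~ contains (cycle_graph 9) near_K55.
Proof.
apply/contains_cycleP => // -[s [sz_s _ cyc_s]].
have flip x p : path (adj near_K55) x p -> side (last x p) = side x (+) odd (size p).
  elim: p x => [|y p IHp] x /=; first by rewrite addbF.
  rewrite adj_near_K55 => /andP[/andP[sxy _] /IHp->]; rewrite addbN -addNb.
  by congr (_ (+) _); move: sxy; case: (side x); case: (side y).
case: s sz_s cyc_s => //= x p [sz_p] /flip.
by rewrite last_rcons size_rcons sz_p addbT; case: (side x).
Qed.

(** A blue cycle that avoids an end of the removed edge stays on one side, which
    has five vertices.  Otherwise remove this end from the cycle: the other five
    vertices are on one side.  It is not that of the removed vertex, and on the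
    opposite side the latter has at most one blue neighbour, while it had two
    on the cycle. *)
Lemma near_K55_no_blue_C6 : ~~ contains (cycle_graph 6) (compl_graph near_K55).
Proof.
apply/contains_cycleP => // -[s [sz_s s_uniq cyc_s]].
have blue u v : adj (compl_graph near_K55) u v -> side u = side v \/ gap u v || gap v u.
  rewrite adj_compl adj_near_K55 negb_and !negbK => /andP[_ /orP[/eqP|]]; first by left.
  by right.
have one_side c t : uniq t -> all (fun u => side u == c) t -> size t <= 5.
  move=> t_uniq /allP side_t.
  pose half : seq V := map (if c then inr else inl) (enum 'I_5).
  have := @uniq_leq_size _ t half t_uniq.
  rewrite size_map size_enum_ord; apply=> u /side_t /eqP; rewrite /half => <-.
  by case: u => i; apply: map_f; rewrite mem_enum.
have no_gap x p : path (adj (compl_graph near_K55)) x p -> inl ord0 \notin x :: p ->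
    all (fun u => side u == side x) (x :: p).
  elim: p x => [|y p IHp] x; first by rewrite /= eqxx.
  case/andP=> /blue xy path_p; rewrite inE negb_or => /andP[x0 p0].
  suff eq_xy : side x = side y by have := IHp y path_p p0; rewrite /= eq_xy eqxx.
  case: xy => // /orP[] /and3P[_ def_u def_v]; first by rewrite eq_sym def_u in x0.
  by rewrite inE eq_sym def_u in p0.
have inl0 : inl ord0 \in s.
  case: s => [|x p] // in sz_s s_uniq cyc_s *.
  apply: contraT => s0; move: cyc_s; rewrite /= rcons_path => /andP[path_p _].
  by have := one_side _ _ s_uniq (no_gap _ _ path_p s0); rewrite sz_s.
have [t [sz_t t_uniq cyc_t]] := cycle_from inl0 s_uniq cyc_s.
case: t sz_t t_uniq cyc_t => [|y t]; rewrite sz_s // => -[sz_t].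
rewrite cons_uniq => /andP[t0 t_uniq]; rewrite /= rcons_path => /and3P[xy path_t tx].
have all_t := no_gap _ _ path_t t0.
have gap0 u : side u -> adj (compl_graph near_K55) (inl ord0) u -> u = inr ord0.
  by move=> side_u /blue; rewrite side_u => -[|/orP[]/and3P[_ // _ /eqP]].
case side_y: (side y) all_t => all_t; last first.
  have := one_side false (inl ord0 :: y :: t); rewrite cons_uniq t0 t_uniq.
  by move=> /(_ isT all_t); rewrite /= -sz_t.
have def_y : y = inr ord0 by apply: gap0.
have last_y : last y t = y.
  have side_last : side (last y t).
    by have /allP/(_ _ (mem_last y t))/eqP := all_t.
  by rewrite [RHS]def_y; apply: gap0; rewrite // adj_sym.
case: t sz_t t_uniq last_y {all_t t0 path_t tx} => //= x t _ /andP[y't _] last_y.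
by rewrite -{1}last_y mem_last in y't.
Qed.

End K55.

(** * The classification *)

Lemma isoclass_Hclasses n (T : finType) (G : graph T) : #|T| = n.+1 ->
    ~~ contains (cycle_graph n) G -> ~~ contains (cycle_graph 6) (compl_graph G) ->
  isoclass n.+1 G \in Hclasses n.
Proof.
move=> card_T noR noB; have [H HG] := relabel G card_T.
apply/imsetP; exists H; last by apply/esym/isoclass_eq.
rewrite inE; apply/andP; split; [apply: contra noR | apply: contra noB].
  exact: contains_iso.
exact: contains_iso (isomorphic_compl HG).
Qed.

Lemma Fclasses_sub r : 2 < r -> Fclasses r \subset Hclasses r.+1.
Proof.
move=> r_gt2; apply/subsetP => C /imsetP[[[[F ay] az] eps]].
rewrite inE /= => ok ->{C}.
apply: isoclass_Hclasses; first by rewrite card_sum card_ord card_bool addn2.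
  exact: attach_no_red_cycle.
exact: attach_no_blue_C6.
Qed.

Definition model_classes n ts : {set {set graph 'I_n}} :=
  [set C in [seq isoclass n (model n t) | t <- ts]].

Lemma patterns_Fclasses r :
  model_classes r.+4.+2 (map inl patterns) \subset Fclasses r.+4.
Proof.
apply/subsetP => C; rewrite inE -map_comp => /mapP[p p_in ->].
have fits_p : fits_in r.+3 p.
  have /allP : all (fits_in r.+3) patterns by [].
  by apply.
have /allP/(_ p p_in) := permitted_patterns r.
case: p fits_p {p_in} => [[[F ay] az] eps] fits_p ok.
apply/imsetP; exists (drawn r.+3 F, omap inord ay, omap inord az, eps).
  by rewrite inE.
by apply/esym/isoclass_eq; apply: attached_model fits_p.
Qed.

Lemma Hclasses_sub n ts :
    grows n.+3 n.+1 [:: n.+2] (matches ts n.+3) -> 1 < n ->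
    (forall G : graph 'I_n.+3, ~~ contains (cycle_graph n.+2) G ->
       ~~ contains (cycle_graph 6) (compl_graph G) ->
       contains (cycle_graph n.+1) G) ->
  Hclasses n.+2 \subset model_classes n.+3 ts.
Proof.
move=> grow n_gt1 hasC; apply/subsetP => C /imsetP[G].
rewrite inE => /andP[noR noB] ->{C}; rewrite inE.
have [||t ts_t Gt] := grows_isomorphic grow _ _ (hasC G noR noB) noR noB => //.
  by rewrite card_ord.
by rewrite (isoclass_eq _ Gt); apply: map_f.
Qed.

Lemma Hclasses8_sub : Hclasses 8 \subset model_classes 9 templates8.
Proof.
apply: Hclasses_sub grows_8 _ _ => // G noC8 noB.
have le9 : 9 <= #|'I_9| by rewrite card_ord.
by have [//|C8] := red_C7_or_C8 le9 noB; rewrite C8 in noC8.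
Qed.

Lemma Hclasses9_sub : Hclasses 9 \subset model_classes 10 templates9.
Proof.
apply: Hclasses_sub grows_9 _ _ => // G _ noB.
by apply: red_C8 noB; rewrite card_ord.
Qed.

Lemma near_K55_classes :
  [set isoclass 10 K55; isoclass 10 K55_minus_edge]
    = model_classes 10 [:: inr false; inr true].
Proof.
apply/setP => C; rewrite !inE.
by rewrite (isoclass_eq _ (near_K55_model false)) (isoclass_eq _ (near_K55_model true)).
Qed.

Lemma model_classes_cat n ts ts' :
  model_classes n (ts ++ ts') = model_classes n ts :|: model_classes n ts'.
Proof. by apply/setP => C; rewrite !inE map_cat mem_cat. Qed.

Lemma near_K55_Hclasses :
  [set isoclass 10 K55; isoclass 10 K55_minus_edge] \subset Hclasses 9.
Proof.
have near_H b : isoclass 10 (near_K55 b) \in Hclasses 9.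
  apply: isoclass_Hclasses; first by rewrite card_sum !card_ord.
    exact: near_K55_no_red_C9.
  exact: near_K55_no_blue_C6.
by rewrite subUset !sub1set (near_H false) (near_H true).
Qed.

Theorem theoremA2 :
  [/\ Hclasses 8 = Fclasses 7,
      Hclasses 9 = Fclasses 8 :|: [set isoclass 10 K55; isoclass 10 K55_minus_edge],
      #|Hclasses 8| = 24 &
      #|Hclasses 9| = 26].
Proof.
have H8F7 : Hclasses 8 \subset Fclasses 7.
  exact: subset_trans Hclasses8_sub (patterns_Fclasses 3).
have H9F8 : model_classes 10 templates9 \subset
    Fclasses 8 :|: [set isoclass 10 K55; isoclass 10 K55_minus_edge].
  by rewrite model_classes_cat near_K55_classes setSU // patterns_Fclasses.
have F8H9 : Fclasses 8 :|: [set isoclass 10 K55; isoclass 10 K55_minus_edge]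
    \subset Hclasses 9.
  by rewrite subUset Fclasses_sub // near_K55_Hclasses.
split.
- by apply/eqP; rewrite eqEsubset H8F7 Fclasses_sub.
- apply/eqP; rewrite eqEsubset F8H9 andbT.
  exact: subset_trans Hclasses9_sub H9F8.
- have -> : Hclasses 8 = model_classes 9 templates8.
    apply/eqP; rewrite eqEsubset Hclasses8_sub.
    by apply: subset_trans (patterns_Fclasses 3) _; apply: Fclasses_sub.
  exact: card_model_classes uniq_profile8.
have -> : Hclasses 9 = model_classes 10 templates9.
  apply/eqP; rewrite eqEsubset Hclasses9_sub.
  exact: subset_trans H9F8 F8H9.
exact: card_model_classes uniq_profile9.
Qed.
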